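(* If a sequent is derivable in $\mathrm{LK}^{+}$, then it is already derivable in $\mathrm{LK}$.
   Context: Sequents. First-order formulae are built with $\bot,\wedge,\vee,\to,\forall,\exists$ ($\neg A$ is $A\to\bot$); free variables $a,b,c,\dots$ and bound variables $x,y,z,\dots$ are separate symbols; terms $t,s,\dots$ contain no bound variables (free variables are allowed). A sequent is $\Gamma\vdash\Delta$ with $\Gamma,\Delta$ finite lists of formulae. Derivations (also called proofs) are finite trees of sequents with axioms at the leaves and inferences at inner nodes; the root is the conclusion. $\mathrm{LK}$. Axioms: $\bot\vdash$ and $A\vdash A$ ($A$ atomic). Structural rules: weakening (from $\Gamma\vdash\Delta$ infer $\Gamma,A\vdash\Delta$ or $\Gamma\vdash\Delta,A$); contraction (from $\Gamma,A,A\vdash\Delta$ infer $\Gamma,A\vdash\Delta$; from $\Gamma\vdash\Delta,A,A$ infer $\Gamma\vdash\Delta,A$); exchange of adjacent formulae on either side; Cut (from $\Gamma\vdash\Delta,A$ and $A,\Gamma\vdash\Delta$ infer $\Gamma\vdash\Delta$). Logical rules: from $\Gamma,A\vdash\Delta$, or from $\Gamma,B\vdash\Delta$, infer $\Gamma,A\wedge B\vdash\Delta$; from $\Gamma\vdash\Delta,A$ and $\Gamma\vdash\Delta,B$ infer $\Gamma\vdash\Delta,A\wedge B$; from $\Gamma\vdash\Delta,A$, or from $\Gamma\vdash\Delta,B$, infer $\Gamma\vdash\Delta,A\vee B$; from $\Gamma,A\vdash\Delta$ and $\Gamma,B\vdash\Delta$ infer $\Gamma,A\vee B\vdash\Delta$;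 ($\to L$) from $\Gamma\vdash\Delta,A$ and $\Gamma,B\vdash\Delta$ infer $\Gamma,A\to B\vdash\Delta$; ($\to R$) from $\Gamma,A\vdash\Delta,B$ infer $\Gamma\vdash\Delta,A\to B$. Weak quantifier inferences: ($\forall L$) from $\Gamma,A(t)\vdash\Delta$ infer $\Gamma,\forall x\,A(x)\vdash\Delta$; ($\exists R$) from $\Gamma\vdash\Delta,A(t)$ infer $\Gamma\vdash\Delta,\exists x\,A(x)$. Strong quantifier inferences: ($\forall R$) from $\Gamma\vdash\Delta,A(a)$ infer $\Gamma\vdash\Delta,\forall x\,A(x)$; ($\exists L$) from $\Gamma,A(a)\vdash\Delta$ infer $\Gamma,\exists x\,A(x)\vdash\Delta$; here $a$ is a free variable, the characteristic variable of the inference, and the newly quantified formula is the critical formula. In $\mathrm{LK}$, the only restriction is that in $\forall R$ and $\exists L$ the variable $a$ does not appear in the conclusion of the inference. $\mathrm{LK}^{+}$. For a derivation $\pi$, write $a<_\pi b$ (''$b$ is a side variable of $a$'') if $\pi$ contains a strong quantifier inference with characteristic variable $a$ whose critical formula ($\forall x\,A(x,b,\vec c)$ on the right or $\exists x\,A(x,b,\vec c)$ on the left, inferred from $A(a,b,\vec c)$) contains the free variable $b$. A quantifier inference is suitable for $\pi$ if it is a weak quantifier inference, or all of the following hold: (substitutability) its characteristic variable does not appear in the conclusion of $\pi$; (side-variable condition) the relation $<_\pi$ is acyclic; (weak regularity) its characteristic variable is not the characteristic variable of another strong quantifier inference in $\pi$. $\mathrm{LK}^{+}$ is defined like $\mathrm{LK}$,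 except that the restriction on $\forall R,\exists L$ is dropped and instead all quantifier inferences are allowed with the proviso that they be suitable for the whole proof $\pi$. *)

(* Defs.v *)
From mathcomp Require Import all_boot.
From Stdlib Require Import Relations.
Set Implicit Arguments.
Unset Strict Implicit.
Unset Printing Implicit Defensive.

Record signature := Signature {
  fsym : Type;
  farity : fsym -> nat;
  psym : Type;
  parity : psym -> nat
}.

(* Well-scoped syntax: free variables are the names [Free a], a : nat; bound
   variables are de Bruijn indices ([ord0] is the innermost binder).  The
   parameter n counts the bound variables in scope, so that a proper term is an
   element of [term L 0] and a proper formula an element of [form L 0]. *)
Inductive term (L : signature) (n : nat) : Type :=
| Bound of 'I_n
| Free of nat
| App (f : fsym L) of ('I_(farity f) -> term L n).

Arguments Free {L n} a.

Inductive form (L : signature) (n : nat) : Type :=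
| Bot
| Atom (p : psym L) of ('I_(parity p) -> term L n)
| And of form L n & form L n
| Or of form L n & form L n
| Imp of form L n & form L n
| All of form L n.+1
| Ex of form L n.+1.

Arguments Bot {L n}.

Fixpoint tsubst L m n (s : 'I_m -> term L n) (u : term L m) : term L n :=
  match u with
  | Bound i => s i
  | Free a => Free a
  | App f args => App (fun i => tsubst s (args i))
  end.

Definition up L m n (s : 'I_m -> term L n) (i : 'I_m.+1) : term L n.+1 :=
  if unlift ord0 i is Some j
  then tsubst (fun k => Bound L (lift ord0 k)) (s j)
  else Bound L ord0.

Fixpoint fsubst L m n (s : 'I_m -> term L n) (A : form L m) : form L n :=
  match A with
  | Bot => Bot
  | Atom p args => Atom (fun i => tsubst s (args i))
  | And B C => And (fsubst s B) (fsubst s C)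
  | Or B C => Or (fsubst s B) (fsubst s C)
  | Imp B C => Imp (fsubst s B) (fsubst s C)
  | All B => All (fsubst (up s) B)
  | Ex B => Ex (fsubst (up s) B)
  end.

(* If the body of a quantifier is A(x), then [inst A t] is A(t). *)
Definition inst L (A : form L 1) (t : term L 0) : form L 0 :=
  fsubst (fun _ => t) A.

Fixpoint toccurs L n (a : nat) (u : term L n) : bool :=
  match u with
  | Bound _ => false
  | Free b => a == b
  | App f args => [exists i, toccurs a (args i)]
  end.

Fixpoint foccurs L n (a : nat) (A : form L n) : bool :=
  match A with
  | Bot => false
  | Atom p args => [exists i, toccurs a (args i)]
  | And B C | Or B C | Imp B C => foccurs a B || foccurs a C
  | All B | Ex B => foccurs a B
  end.

Definition sequent L := (seq (form L 0) * seq (form L 0))%type.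

Declare Scope sequent_scope.
Delimit Scope sequent_scope with seqt.
Bind Scope sequent_scope with sequent.
Notation "G |-- D" := (pair G D : sequent _) (at level 80) : sequent_scope.
Local Open Scope sequent_scope.

Definition soccurs L (a : nat) (S : sequent L) : bool :=
  has (foccurs a) S.1 || has (foccurs a) S.2.

(* Trees built with the rules common to LK and LK+, with no condition on the
   characteristic variables of the strong quantifier inferences. *)
Inductive deriv (L : signature) : sequent L -> Type :=
| AxBot : deriv ([:: Bot] |-- [::])
| AxAtom (p : psym L) (args : 'I_(parity p) -> term L 0) :
    deriv ([:: Atom args] |-- [:: Atom args])
| WeakL G D A : deriv (G |-- D) -> deriv (rcons G A |-- D)
| WeakR G D A : deriv (G |-- D) -> deriv (G |-- rcons D A)
| ContrL G D A :
    deriv (rcons (rcons G A) A |-- D) -> deriv (rcons G A |-- D)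
| ContrR G D A :
    deriv (G |-- rcons (rcons D A) A) -> deriv (G |-- rcons D A)
| ExchL G1 G2 D A B :
    deriv (G1 ++ A :: B :: G2 |-- D) -> deriv (G1 ++ B :: A :: G2 |-- D)
| ExchR G D1 D2 A B :
    deriv (G |-- D1 ++ A :: B :: D2) -> deriv (G |-- D1 ++ B :: A :: D2)
| Cut G D A :
    deriv (G |-- rcons D A) -> deriv (A :: G |-- D) -> deriv (G |-- D)
| AndL1 G D A B : deriv (rcons G A |-- D) -> deriv (rcons G (And A B) |-- D)
| AndL2 G D A B : deriv (rcons G B |-- D) -> deriv (rcons G (And A B) |-- D)
| AndR G D A B :
    deriv (G |-- rcons D A) -> deriv (G |-- rcons D B) ->
    deriv (G |-- rcons D (And A B))
| OrR1 G D A B : deriv (G |-- rcons D A) -> deriv (G |-- rcons D (Or A B))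
| OrR2 G D A B : deriv (G |-- rcons D B) -> deriv (G |-- rcons D (Or A B))
| OrL G D A B :
    deriv (rcons G A |-- D) -> deriv (rcons G B |-- D) ->
    deriv (rcons G (Or A B) |-- D)
| ImpL G D A B :
    deriv (G |-- rcons D A) -> deriv (rcons G B |-- D) ->
    deriv (rcons G (Imp A B) |-- D)
| ImpR G D A B :
    deriv (rcons G A |-- rcons D B) -> deriv (G |-- rcons D (Imp A B))
| AllL G D (A : form L 1) (t : term L 0) :
    deriv (rcons G (inst A t) |-- D) -> deriv (rcons G (All A) |-- D)
| ExR G D (A : form L 1) (t : term L 0) :
    deriv (G |-- rcons D (inst A t)) -> deriv (G |-- rcons D (Ex A))
| AllR G D (A : form L 1) (a : nat) :
    deriv (G |-- rcons D (inst A (Free a))) -> deriv (G |-- rcons D (All A))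
| ExL G D (A : form L 1) (a : nat) :
    deriv (rcons G (inst A (Free a)) |-- D) -> deriv (rcons G (Ex A) |-- D).

(* [StrongQ a B S]: characteristic variable a, critical formula B, and
   conclusion S of the inference. *)
Inductive qinference (L : signature) : Type :=
| WeakQ
| StrongQ (a : nat) (B : form L 0) (S : sequent L).

Arguments WeakQ {L}.

(* One entry for each occurrence of a quantifier inference in the tree; an
   inference of the derivation is identified below by its index here. *)
Fixpoint qinferences L (S : sequent L) (d : deriv S) : seq (qinference L) :=
  match d with
  | AxBot | AxAtom _ _ => [::]
  | WeakL _ _ _ d1 | WeakR _ _ _ d1
  | ContrL _ _ _ d1 | ContrR _ _ _ d1
  | ExchL _ _ _ _ _ d1 | ExchR _ _ _ _ _ d1
  | AndL1 _ _ _ _ d1 | AndL2 _ _ _ _ d1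
  | OrR1 _ _ _ _ d1 | OrR2 _ _ _ _ d1
  | ImpR _ _ _ _ d1 => qinferences d1
  | Cut _ _ _ d1 d2
  | AndR _ _ _ _ d1 d2 | OrL _ _ _ _ d1 d2
  | ImpL _ _ _ _ d1 d2 => qinferences d1 ++ qinferences d2
  | AllL _ _ _ _ d1 | ExR _ _ _ _ d1 => WeakQ :: qinferences d1
  | AllR G D A a d1 =>
      StrongQ a (All A) (G |-- rcons D (All A)) :: qinferences d1
  | ExL G D A a d1 =>
      StrongQ a (Ex A) (rcons G (Ex A) |-- D) :: qinferences d1
  end.

Definition qinf L (S : sequent L) (d : deriv S) (i : nat) : qinference L :=
  nth WeakQ (qinferences d) i.

Definition LK_proof L (S : sequent L) (d : deriv S) : Prop :=
  forall i a B T, qinf d i = StrongQ a B T -> ~~ soccurs a T.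

(* a <_d b.  The case b = a is included: the critical formula may contain its
   own characteristic variable, and then the relation has a cycle. *)
Definition side_variable L (S : sequent L) (d : deriv S) (a b : nat) : Prop :=
  exists i B T, qinf d i = StrongQ a B T /\ foccurs b B.

Definition acyclic (T : Type) (R : T -> T -> Prop) : Prop :=
  forall x, ~ clos_trans T R x x.

Definition suitable L (S : sequent L) (d : deriv S) (i : nat) : Prop :=
  match qinf d i with
  | WeakQ => True
  | StrongQ a _ _ =>
      [/\ ~~ soccurs a S,
          acyclic (side_variable d)
        & forall j B T, j <> i -> qinf d j <> StrongQ a B T]
  end.

Definition LKplus_proof L (S : sequent L) (d : deriv S) : Prop :=
  forall i, i < size (qinferences d) -> suitable d i.

Definition LK_derivable L (S : sequent L) : Prop :=
  exists d : deriv S, LK_proof d.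

Definition LKplus_derivable L (S : sequent L) : Prop :=
  exists d : deriv S, LKplus_proof d.

(* Main.v *)
(** Replace every strong quantifier inference of an LK+ proof by an implication
    left inference with the Henkin axiom A(a) -> All x A(x), resp.
    Ex x A(x) -> A(a).  The result is an LK proof of the same sequent with these
    axioms added on the left.  By acyclicity one of the characteristic variables
    is a side variable of no other one; by weak regularity and substitutability
    it then occurs only in its own axiom, and that axiom can be discharged: from
    an LK proof using A(a) -> All x A(x) one gets, by inverting the implication,
    G |- D, A(a) and All x A(x), G |- D, whence G |- D by a generalization over
    a and a cut.  Iterating discharges all the axioms. *)
From Stdlib Require Import List Relations Classical.
From mathcomp Require Import all_boot.
Require Import Defs.
Set Implicit Arguments.
Unset Strict Implicit.
Unset Printing Implicit Defensive.
Local Open Scope sequent_scope.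

(** * Sequences *)

(* Formulae have no decidable equality, whence [In] rather than [\in]. *)
Lemma In_cat T (x : T) s1 s2 : In x (s1 ++ s2) <-> In x s1 \/ In x s2.
Proof. by elim: s1 => [|y s1 IH] /=; rewrite ?IH; tauto. Qed.

Lemma In_rcons T (x : T) s y : In x (rcons s y) <-> In x s \/ x = y.
Proof. by rewrite -cats1 In_cat /=; intuition. Qed.

Lemma In_map T T' (f : T -> T') y s :
  In y (map f s) <-> exists2 x, In x s & f x = y.
Proof.
elim: s => [|z s IH] /=; first by split=> // -[].
split=> [[<- | /IH[x xs <-]] | [x [-> | xs] fx]].
- by exists z; first left.
- by exists x; first right.
- by left.
by right; apply/IH; exists x.
Qed.

Lemma In_mem (T : eqType) (x : T) s : reflect (In x s) (x \in s).
Proof.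
elim: s => [|y s IH]; first by constructor.
rewrite inE eq_sym; apply: (iffP orP) => [] [/eqP | /IH]; by [left | right].
Qed.

Lemma In_split T (x : T) s : In x s -> exists s1 s2, s = s1 ++ x :: s2.
Proof.
elim: s => //= y s IH [-> | /IH[s1 [s2 ->]]]; first by exists [::], s.
by exists (y :: s1), s2.
Qed.

Lemma has_In T (p : pred T) s : has p s <-> exists2 x, In x s & p x.
Proof.
elim: s => [|y s IH] /=; first by split=> // -[].
split=> [/orP[py | /IH[x xs px]] | [x [-> -> // | xs px]]].
- by exists y; first left.
- by exists x; first right.
by apply/orP; right; apply/IH; exists x.
Qed.

Lemma In_nth T (x0 x : T) s : In x s -> exists2 i, i < size s & nth x0 s i = x.
Proof.
elim: s => //= y s IH [-> | /IH[i lt_i <-]]; first by exists 0.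
by exists i.+1.
Qed.

Ltac solve_incl :=
  move=> ?; rewrite /= ?(In_cat, In_rcons) /= ?(In_cat, In_rcons) /=; intuition.

(** Weaken [s] to [s ++ s']; each entry of [s] then has a copy in [s'] with which it can be
    contracted. So one side of a sequent behaves like a set. *)
Lemma structural_closure T (P : seq T -> Prop) :
    (forall s x, P s -> P (rcons s x)) ->
    (forall s x, P (rcons (rcons s x) x) -> P (rcons s x)) ->
    (forall s1 s2 x y, P (s1 ++ x :: y :: s2) -> P (s1 ++ y :: x :: s2)) ->
  forall s s', incl s s' -> P s -> P s'.
Proof.
move=> weak contr exch.
have moveR s1 s2 s3 x : P (s1 ++ x :: s2 ++ s3) -> P (s1 ++ s2 ++ x :: s3).
  elim: s2 s1 => //= y s2 IH s1 /exch; rewrite -cat_rcons => /IH.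
  by rewrite cat_rcons.
have moveL s1 s2 s3 x : P (s1 ++ s2 ++ x :: s3) -> P (s1 ++ x :: s2 ++ s3).
  elim: s2 s1 => //= y s2 IH s1; rewrite -cat_rcons => /IH.
  by rewrite cat_rcons => /exch.
have weak_cat s s' : P s -> P (s ++ s').
  by elim: s' s => [|x s' IH] s; rewrite ?cats0 -?cat_rcons // => /weak/IH.
(* Contraction acts only at the end of the list: both copies of [x] travel there, and the contracted
   one travels back. *)
have absorb x s : In x s -> P (x :: s) -> P s.
  move=> /(@In_split _ x s)[s1 [s2 ->]] /(moveR [::] s1 (x :: s2)) /= P_s.
  have {P_s}: P (s1 ++ x :: s2 ++ [:: x]).
    by have := moveR s1 (x :: s2) [::] x; rewrite /= cats0; apply.
  move/moveR; rewrite catA -cat_rcons cats1 => /contr; rewrite -cats1 -catA.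
  by move/moveL; rewrite cats0.
move=> s s' ss' /(weak_cat s s'); elim: s ss' => //= x s IH ss' Pxs.
apply: IH => [y ys|]; first by apply: ss'; right.
by apply: absorb Pxs; apply/In_cat; right; apply: ss'; left.
Qed.

Lemma acyclic_sub T (R R' : T -> T -> Prop) :
  (forall x y, R x y -> R' x y) -> acyclic R' -> acyclic R.
Proof.
move=> RR' acyc x Rxx; apply: (acyc x); move: Rxx.
have sub y z : clos_trans T R y z -> clos_trans T R' y z; last exact: sub.
elim=> {y z} [y z /RR' | y z w _ R'yz _]; first exact: t_step.
exact: t_trans R'yz.
Qed.

(** Induction on the list: the head replaces the minimal element of the tail when it lies below it.
    Excluded middle decides this, since [R] is arbitrary. *)
Lemma strict_order_minimal T (R : T -> T -> Prop) x0 s :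
    (forall x y z, R x y -> R y z -> R x z) -> (forall x, ~ R x x) ->
  exists2 m, In m (x0 :: s) & forall y, In y (x0 :: s) -> ~ R y m.
Proof.
move=> tr irr; elim: s x0 => [|x s IH] x0.
  by exists x0 => [|y [<- | []]]; [left|].
have [m ms min] := IH x; case: (classic (R x0 m)) => [Rm | nRm].
  by exists x0 => [|y [<- // | ys Ryx]]; [left | apply: (min y ys); apply: tr Rm].
by exists m => [|y [<- // | /min]]; [right|].
Qed.

(** * Free variables *)

Lemma toccurs_subst L m n (s : 'I_m -> term L n) a u :
  toccurs a (tsubst s u) -> toccurs a u \/ exists i, toccurs a (s i).
Proof.
elim: u => [i|b|f args IH] /=; [by right; exists i | by left |].
case/existsP=> i /IH[]; last by right.
by left; apply/existsP; exists i.
Qed.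

Lemma toccurs_up L m n (s : 'I_m -> term L n) a i :
  toccurs a (up s i) -> exists j, toccurs a (s j).
Proof.
rewrite /up; case: unliftP => //= j _ /toccurs_subst[|[] //].
by exists j.
Qed.

Lemma foccurs_subst L m n (s : 'I_m -> term L n) a A :
  foccurs a (fsubst s A) -> foccurs a A \/ exists i, toccurs a (s i).
Proof.
elim: A n s => {m} [//|m p args|m A IHA B IHB|m A IHA B IHB|m A IHA B IHB
  |m A IHA|m A IHA] n s /=.
- case/existsP=> i /toccurs_subst[]; last by right.
  by left; apply/existsP; exists i.
- by case/orP=> [/IHA | /IHB] [-> | ]; rewrite ?orbT; by [left | right].
- by case/orP=> [/IHA | /IHB] [-> | ]; rewrite ?orbT; by [left | right].
- by case/orP=> [/IHA | /IHB] [-> | ]; rewrite ?orbT; by [left | right].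
- by case/IHA=> [|[i /toccurs_up]]; [left | right].
by case/IHA=> [|[i /toccurs_up]]; [left | right].
Qed.

Lemma foccurs_inst L a b (A : form L 1) :
  foccurs a (inst A (Free b)) -> foccurs a A \/ a = b.
Proof. by case/foccurs_subst=> [|[_ /eqP]]; [left | right]. Qed.

(** A bound from which on all names are fresh, unlike a single fresh name, combines over several
    arguments by a maximum. *)
Lemma targs_fresh k (occ : nat -> 'I_k -> bool) :
    (forall i, exists N, forall a, N <= a -> ~~ occ a i) ->
  exists N, forall a, N <= a -> ~~ [exists i, occ a i].
Proof.
case/fin_all_exists=> N freshN; exists (\max_i N i) => a leNa.
by apply/existsPn=> i; apply: freshN; apply: leq_trans leNa; apply: leq_bigmax.
Qed.

Lemma tfresh L n (u : term L n) : exists N, forall a, N <= a -> ~~ toccurs a u.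
Proof.
elim: u => [i|b|f args IH] /=; first by exists 0.
  by exists b.+1 => a ltba; rewrite gtn_eqF.
exact: targs_fresh.
Qed.

Lemma ffresh L n (A : form L n) : exists N, forall a, N <= a -> ~~ foccurs a A.
Proof.
have fresh2 m (B C : form L m) :
    (exists N, forall a, N <= a -> ~~ foccurs a B) ->
    (exists N, forall a, N <= a -> ~~ foccurs a C) ->
  exists N, forall a, N <= a -> ~~ (foccurs a B || foccurs a C).
- move=> [N1 fr1] [N2 fr2]; exists (maxn N1 N2) => a.
  by rewrite geq_max negb_or => /andP[/fr1-> /fr2->].
elim: A => {n} [n|n p args|n B IHB C IHC|n B IHB C IHC|n B IHB C IHC|//|//] /=;
  try exact: fresh2.
  by exists 0.
by apply: targs_fresh => i; apply: tfresh.
Qed.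

(** Measure for the induction in [LK_id]: [inst A t] is not a subterm of [All A], but it has smaller
    depth. *)
Fixpoint fdepth L n (A : form L n) : nat :=
  match A with
  | Bot | Atom _ _ => 0
  | And B C | Or B C | Imp B C => (maxn (fdepth B) (fdepth C)).+1
  | All B | Ex B => (fdepth B).+1
  end.

Lemma fdepth_subst L m n (s : 'I_m -> term L n) A :
  fdepth (fsubst s A) = fdepth A.
Proof.
by elim: A n s => {m} //= [m A IHA B IHB|m A IHA B IHB|m A IHA B IHB
  |m A IHA|m A IHA] n s; rewrite ?IHA ?IHB.
Qed.

(** * Derived rules of LK *)

Section LKRules.
Variable L : signature.
Implicit Types (S T : sequent L) (G D X : seq (form L 0)) (A B C : form L 0).

Definition strong_fresh (q : qinference L) : Prop :=
  if q is StrongQ a _ T then ~~ soccurs a T else True.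

Lemma LK_proofE S (d : deriv S) :
  LK_proof d <-> forall q, In q (qinferences d) -> strong_fresh q.
Proof.
split=> [LKd q /(@In_nth _ WeakQ)[i _ def_q] | LKd i a B T def_q].
  by case: q def_q => //= a B T /LKd.
(* Out of range, [nth] returns the default [WeakQ], so a strong inference found at [i] is a genuine
   entry. *)
suff /LKd: In (StrongQ a B T) (qinferences d) by [].
move: def_q; rewrite /qinf; elim: (qinferences d) i => [|q l IH] [|i] //=.
  by left.
by move/IH; right.
Qed.

(** The LK condition on an inference concerns only its own conclusion, so it survives when the tree
    is extended; only what [r] adds has to be checked. *)
Lemma LK_rule1 S T (r : deriv T -> deriv S) :
    (forall d q, In q (qinferences (r d)) -> strong_fresh q \/ In q (qinferences d)) ->
  LK_derivable T -> LK_derivable S.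
Proof.
move=> qr [d /LK_proofE LKd]; exists (r d).
by apply/LK_proofE=> q /qr[|/LKd].
Qed.

Lemma LK_rule2 S (S1 S2 : sequent L) (r : deriv S1 -> deriv S2 -> deriv S) :
    (forall d1 d2, qinferences (r d1 d2) = qinferences d1 ++ qinferences d2) ->
  LK_derivable S1 -> LK_derivable S2 -> LK_derivable S.
Proof.
move=> qr [d1 /LK_proofE LKd1] [d2 /LK_proofE LKd2]; exists (r d1 d2).
by apply/LK_proofE=> q; rewrite qr => /In_cat[/LKd1 | /LKd2].
Qed.

Lemma LK_incl G G' D D' : incl G G' -> incl D D' ->
  LK_derivable (G |-- D) -> LK_derivable (G' |-- D').
Proof.
move=> GG' DD' LKd.
have {}LKd: LK_derivable (G' |-- D).
  apply: (structural_closure (P := fun G => LK_derivable (G |-- D))) GG' LKd.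
  - by move=> G1 A; apply: (LK_rule1 (r := @WeakL L G1 D A)); auto.
  - by move=> G1 A; apply: (LK_rule1 (r := @ContrL L G1 D A)); auto.
  by move=> G1 G2 A B; apply: (LK_rule1 (r := @ExchL L G1 G2 D A B)); auto.
apply: (structural_closure (P := fun D => LK_derivable (G' |-- D))) DD' LKd.
- by move=> D1 A; apply: (LK_rule1 (r := @WeakR L G' D1 A)); auto.
- by move=> D1 A; apply: (LK_rule1 (r := @ContrR L G' D1 A)); auto.
by move=> D1 D2 A B; apply: (LK_rule1 (r := @ExchR L G' D1 D2 A B)); auto.
Qed.

Lemma LK_Cut A G D : LK_derivable (G |-- rcons D A) ->
  LK_derivable (A :: G |-- D) -> LK_derivable (G |-- D).
Proof. by apply: (LK_rule2 (r := @Cut L G D A)); auto. Qed.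

Lemma LK_AndL1 G D A B : LK_derivable (rcons G A |-- D) ->
  LK_derivable (rcons G (And A B) |-- D).
Proof. by apply: (LK_rule1 (r := @AndL1 L G D A B)); auto. Qed.

Lemma LK_AndL2 G D A B : LK_derivable (rcons G B |-- D) ->
  LK_derivable (rcons G (And A B) |-- D).
Proof. by apply: (LK_rule1 (r := @AndL2 L G D A B)); auto. Qed.

Lemma LK_AndR G D A B : LK_derivable (G |-- rcons D A) ->
  LK_derivable (G |-- rcons D B) -> LK_derivable (G |-- rcons D (And A B)).
Proof. by apply: (LK_rule2 (r := @AndR L G D A B)); auto. Qed.

Lemma LK_OrR1 G D A B : LK_derivable (G |-- rcons D A) ->
  LK_derivable (G |-- rcons D (Or A B)).
Proof. by apply: (LK_rule1 (r := @OrR1 L G D A B)); auto. Qed.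

Lemma LK_OrR2 G D A B : LK_derivable (G |-- rcons D B) ->
  LK_derivable (G |-- rcons D (Or A B)).
Proof. by apply: (LK_rule1 (r := @OrR2 L G D A B)); auto. Qed.

Lemma LK_OrL G D A B : LK_derivable (rcons G A |-- D) ->
  LK_derivable (rcons G B |-- D) -> LK_derivable (rcons G (Or A B) |-- D).
Proof. by apply: (LK_rule2 (r := @OrL L G D A B)); auto. Qed.

Lemma LK_ImpL G D A B : LK_derivable (G |-- rcons D A) ->
  LK_derivable (rcons G B |-- D) -> LK_derivable (rcons G (Imp A B) |-- D).
Proof. by apply: (LK_rule2 (r := @ImpL L G D A B)); auto. Qed.

Lemma LK_ImpR G D A B : LK_derivable (rcons G A |-- rcons D B) ->
  LK_derivable (G |-- rcons D (Imp A B)).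
Proof. by apply: (LK_rule1 (r := @ImpR L G D A B)); auto. Qed.

Lemma LK_AllL t G D (A : form L 1) : LK_derivable (rcons G (inst A t) |-- D) ->
  LK_derivable (rcons G (All A) |-- D).
Proof.
by apply: (LK_rule1 (r := @AllL L G D A t)) => d q [<- |]; [left | right].
Qed.

Lemma LK_ExR t G D (A : form L 1) : LK_derivable (G |-- rcons D (inst A t)) ->
  LK_derivable (G |-- rcons D (Ex A)).
Proof.
by apply: (LK_rule1 (r := @ExR L G D A t)) => d q [<- |]; [left | right].
Qed.

Lemma LK_AllR a G D (A : form L 1) : ~~ soccurs a (G |-- rcons D (All A)) ->
  LK_derivable (G |-- rcons D (inst A (Free a))) ->
  LK_derivable (G |-- rcons D (All A)).
Proof.
move=> fresh_a.
by apply: (LK_rule1 (r := @AllR L G D A a)) => d q [<- |]; [left | right].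
Qed.

Lemma LK_ExL a G D (A : form L 1) : ~~ soccurs a (rcons G (Ex A) |-- D) ->
  LK_derivable (rcons G (inst A (Free a)) |-- D) ->
  LK_derivable (rcons G (Ex A) |-- D).
Proof.
move=> fresh_a.
by apply: (LK_rule1 (r := @ExL L G D A a)) => d q [<- |]; [left | right].
Qed.

(** Axioms are atomic, so compound formulae need an induction; a name fresh for the body serves as
    characteristic variable in the quantifier cases. *)
Lemma LK_id A : LK_derivable ([:: A] |-- [:: A]).
Proof.
move: {2}(fdepth A).+1 (ltnSn (fdepth A)) => k.
elim: k A => // k IH [|p args|B C|B C|B C|B|B] /=; rewrite ltnS => ltk.
- suff: LK_derivable ([:: @Bot L 0] |-- [::]) by apply: LK_incl; solve_incl.
  by exists (AxBot L) => -[].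
- by exists (AxAtom args) => -[].
- move: ltk; rewrite gtn_max => /andP[/IH idB /IH idC].
  apply: (@LK_AndR _ [::]).
    by apply: (@LK_AndL1 [::]).
  by apply: (@LK_AndL2 [::]).
- move: ltk; rewrite gtn_max => /andP[/IH idB /IH idC].
  apply: (@LK_OrL [::]).
    by apply: (@LK_OrR1 _ [::]).
  by apply: (@LK_OrR2 _ [::]).
- move: ltk; rewrite gtn_max => /andP[/IH idB /IH idC].
  apply: (@LK_ImpR _ [::]).
  suff: LK_derivable (rcons [:: B] (Imp B C) |-- [:: C]).
    by apply: LK_incl; solve_incl.
  by apply: LK_ImpL; [move: idB | move: idC]; apply: LK_incl; solve_incl.
- have [a /(_ a (leqnn a)) fresh_a] := ffresh B.
  apply: (@LK_AllR a _ [::]); first by rewrite /soccurs /= !orbF orbb.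
  by apply: (@LK_AllL (Free a) [::]); apply: IH; rewrite fdepth_subst.
have [a /(_ a (leqnn a)) fresh_a] := ffresh B.
apply: (@LK_ExL a [::]); first by rewrite /soccurs /= !orbF orbb.
by apply: (@LK_ExR (Free a) _ [::]); apply: IH; rewrite fdepth_subst.
Qed.

(** Cut on [Imp A B]: it is derivable on the right both next to [A] on the right and from [B] on the
    left. *)
Lemma LK_Imp_inv G D A B : LK_derivable (Imp A B :: G |-- D) ->
  LK_derivable (G |-- rcons D A) /\ LK_derivable (B :: G |-- D).
Proof.
move=> LKd; split; apply: (@LK_Cut (Imp A B)).
- by apply: LK_ImpR; move: (LK_id A); apply: LK_incl; solve_incl.
- by move: LKd; apply: LK_incl; solve_incl.
- by apply: LK_ImpR; move: (LK_id B); apply: LK_incl; solve_incl.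
by move: LKd; apply: LK_incl; solve_incl.
Qed.

(** * Henkin axioms *)

(* The last branch is junk: a critical formula is quantified.  [Imp B B] can be
   discharged like the other axioms and has no free variable outside [B]. *)
Definition henkin (p : nat * form L 0) : form L 0 :=
  match p.2 with
  | All A => Imp (inst A (Free p.1)) (All A)
  | Ex A => Imp (Ex A) (inst A (Free p.1))
  | B => Imp B B
  end.

Lemma foccurs_henkin a p : foccurs a (henkin p) -> foccurs a p.2 \/ a = p.1.
Proof.
case: p => c [|q args|B C|B C|B C|B|B] /=; rewrite ?orbb; try by left.
  by case/orP=> [/foccurs_inst | ->]; [|left].
by case/orP=> [-> | /foccurs_inst]; [left|].
Qed.

(** The freshness hypotheses are what LK demands for generalizing over [a] once inversion has split
    the axiom. *)
Lemma LK_discharge a B G D :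
    ~~ foccurs a B -> ~~ soccurs a (G |-- D) ->
  LK_derivable (henkin (a, B) :: G |-- D) -> LK_derivable (G |-- D).
Proof.
rewrite /soccurs /= negb_or => fresh_B /andP[fresh_G fresh_D].
have triv C : LK_derivable (Imp C C :: G |-- D) -> LK_derivable (G |-- D).
  by case/LK_Imp_inv; apply: LK_Cut.
rewrite /henkin /=; case: B fresh_B => [|p args|B C|B C|B C|A|A] fresh_A;
  try exact: triv; case/LK_Imp_inv=> LK1 LK2.
  apply: LK_Cut LK2; apply: LK_AllR LK1.
  by rewrite /soccurs /= has_rcons !negb_or fresh_G fresh_D andbT.
(* Dual case: inversion gives G |- D, Ex x A(x) and A(a), G |- D; the existential is introduced in
   the latter, then cut. *)
apply: LK_Cut LK1 _.
suff: LK_derivable (rcons G (Ex A) |-- D) by apply: LK_incl; solve_incl.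
apply: (@LK_ExL a).
  by rewrite /soccurs /= has_rcons !negb_or fresh_G fresh_D !andbT.
by move: LK2; apply: LK_incl; solve_incl.
Qed.

(** [X] may be any list containing the needed axioms, so that both premises of a rule can share
    it. *)
Lemma LK_henkin S (d : deriv S) X :
    (forall a B T, In (StrongQ a B T) (qinferences d) -> In (henkin (a, B)) X) ->
  LK_derivable (X ++ S.1 |-- S.2).
Proof.
elim: d => {S} /=.
- move=> _; suff: LK_derivable ([:: @Bot L 0] |-- [::]).
    by apply: LK_incl; solve_incl.
  by exists (AxBot L) => -[].
- by move=> p args _; move: (LK_id (Atom args)); apply: LK_incl; solve_incl.
- by move=> G D A d IH /IH; apply: LK_incl; solve_incl.
- by move=> G D A d IH /IH; apply: LK_incl; solve_incl.
- by move=> G D A d IH /IH; apply: LK_incl; solve_incl.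
- by move=> G D A d IH /IH; apply: LK_incl; solve_incl.
- by move=> G1 G2 D A B d IH /IH; apply: LK_incl; solve_incl.
- by move=> G D1 D2 A B d IH /IH; apply: LK_incl; solve_incl.
- move=> G D A d1 IH1 d2 IH2 inX; apply: (@LK_Cut A).
    by apply: IH1 => a B T ?; apply: (inX a B T); apply/In_cat; left.
  suff: LK_derivable (X ++ A :: G |-- D) by apply: LK_incl; solve_incl.
  by apply: IH2 => a B T ?; apply: (inX a B T); apply/In_cat; right.
- by move=> G D A B d IH /IH; rewrite -!rcons_cat; apply: LK_AndL1.
- by move=> G D A B d IH /IH; rewrite -!rcons_cat; apply: LK_AndL2.
- move=> G D A B d1 IH1 d2 IH2 inX; apply: LK_AndR.
    by apply: IH1 => a C T ?; apply: (inX a C T); apply/In_cat; left.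
  by apply: IH2 => a C T ?; apply: (inX a C T); apply/In_cat; right.
- by move=> G D A B d IH /IH; apply: LK_OrR1.
- by move=> G D A B d IH /IH; apply: LK_OrR2.
- move=> G D A B d1 IH1 d2 IH2 inX; rewrite -rcons_cat.
  apply: LK_OrL; rewrite rcons_cat.
    by apply: IH1 => a C T ?; apply: (inX a C T); apply/In_cat; left.
  by apply: IH2 => a C T ?; apply: (inX a C T); apply/In_cat; right.
- move=> G D A B d1 IH1 d2 IH2 inX; rewrite -rcons_cat.
  apply: LK_ImpL; rewrite ?rcons_cat.
    by apply: IH1 => a C T ?; apply: (inX a C T); apply/In_cat; left.
  by apply: IH2 => a C T ?; apply: (inX a C T); apply/In_cat; right.
- by move=> G D A B d IH /IH; rewrite -!rcons_cat; apply: LK_ImpR.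
- move=> G D A t d IH inX; rewrite -rcons_cat; apply: (@LK_AllL t).
  by rewrite rcons_cat; apply: IH => a B T ?; apply: (inX a B T); right.
- move=> G D A t d IH inX; apply: (@LK_ExR t).
  by apply: IH => a B T ?; apply: (inX a B T); right.
- move=> G D A a d IH inX.
  have axX: In (Imp (inst A (Free a)) (All A)) X.
    by apply: (inX a (All A)); left.
  have {inX}LKd: LK_derivable (X ++ G |-- rcons D (inst A (Free a))).
    by apply: IH => b B T ?; apply: (inX b B T); right.
  (* Implication left, from the premise and the identity on [All A], creates another copy of the
     Henkin axiom, which merges with the one in [X]. *)
  suff: LK_derivable (rcons (X ++ G) (Imp (inst A (Free a)) (All A))
                      |-- rcons D (All A)).
    by apply: LK_incl; solve_incl; subst; auto.
  apply: LK_ImpL; first by move: LKd; apply: LK_incl; solve_incl.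
  by move: (LK_id (All A)); apply: LK_incl; solve_incl.
move=> G D A a d IH inX.
have axX: In (Imp (Ex A) (inst A (Free a))) X.
  by apply: (inX a (Ex A)); left.
have {inX}LKd: LK_derivable (X ++ rcons G (inst A (Free a)) |-- D).
  by apply: IH => b B T ?; apply: (inX b B T); right.
suff: LK_derivable (rcons (X ++ rcons G (Ex A)) (Imp (Ex A) (inst A (Free a)))
                    |-- D).
  by apply: LK_incl; solve_incl; subst; auto.
apply: LK_ImpL; first by move: (LK_id (Ex A)); apply: LK_incl; solve_incl.
by move: LKd; apply: LK_incl; solve_incl.
Qed.

(** * Discharging all Henkin axioms *)

Definition side (s : seq (nat * form L 0)) (a b : nat) : Prop :=
  exists2 B, In (a, B) s & foccurs b B.

(** Induction on the number of axioms. [side] depends on the list alone, so it shrinks with the list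
    and stays acyclic. *)
Lemma LK_discharge_all (s : seq (nat * form L 0)) G D :
    uniq (map fst s) -> acyclic (side s) ->
    (forall a : nat, a \in map fst s -> ~~ soccurs a (G |-- D)) ->
  LK_derivable (map henkin s ++ G |-- D) -> LK_derivable (G |-- D).
Proof.
move: {2}(size s) (erefl (size s)) => k; elim: k s => [|k IH] s.
  by move/size0nil->.
move=> size_s uniq_s acyc fresh_s LKs.
(* By acyclicity the transitive closure of [side] is a strict order; for a minimal pair, [a] lies in
   no critical formula, not even its own. *)
have [[a B] in_s min_a]: exists2 m, In m s & forall p, In p s -> ~ side s p.1 m.1.
  case: s size_s acyc {uniq_s fresh_s LKs} => // p s _ acyc.
  have [|x /acyc //|m in_s min_m] :=
    @strict_order_minimal _ (fun q r => clos_trans _ (side (p :: s)) q.1 r.1) p s.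
    by move=> x y z; apply: t_trans.
  by exists m => // q /min_m nR Rqm; apply: nR; apply: t_step.
have [s1 [s2 def_s]] := In_split in_s.
move: {in_s} acyc size_s uniq_s fresh_s LKs min_a; rewrite {s}def_s => acyc.
rewrite size_cat /= addnS => -[size_s].
rewrite map_cat /= -cat_rcons -cats1 -catA uniq_catCA /= => /andP[a_s uniq_s].
rewrite -map_cat in a_s uniq_s * => fresh_s LKs min_a.
have fresh_side p : In p (s1 ++ (a, B) :: s2) -> ~~ foccurs a p.2.
  move=> in_s; apply/negP=> occ_a; apply: (min_a p) => //.
  by exists p.2 => //; case: p in_s {occ_a}.
apply: (IH (s1 ++ s2)) => //.
- by rewrite size_cat.
- apply: acyclic_sub acyc => x y [C in_s occ_y]; exists C => //.
  by move: in_s; rewrite !In_cat /=; tauto.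
- move=> c; rewrite map_cat mem_cat => in_s; apply: fresh_s.
  by rewrite mem_cat inE orbCA in_s orbT.
apply: (@LK_discharge a B).
- by apply: (fresh_side (a, B)); rewrite In_cat /=; tauto.
- have: ~~ soccurs a (G |-- D) by apply: fresh_s; rewrite !mem_cat inE eqxx ?orbT.
  rewrite /soccurs /= !negb_or => /andP[fresh_G ->]; rewrite andbT.
  (* If [a] occurred in a remaining axiom, it would lie in a critical formula, against minimality,
     or be its characteristic variable, against uniqueness. *)
  apply/negP=> /has_In[C /In_cat[] in_C occ_a]; last first.
    by case/negP: fresh_G; apply/has_In; exists C.
  case/In_map: in_C occ_a => p in_p <- /foccurs_henkin[|def_a].
    by apply/negP/fresh_side; move: in_p; rewrite !In_cat /=; tauto.
  by case/negP: a_s; apply/In_mem/In_map; exists p.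
by move: LKs; rewrite !map_cat; apply: LK_incl; solve_incl.
Qed.

(** * Extracting the characteristic variables of a derivation *)

Definition strong (q : qinference L) : option (nat * form L 0) :=
  if q is StrongQ a B _ then Some (a, B) else None.

Lemma In_pmap_strong a B (l : seq (qinference L)) :
  In (a, B) (pmap strong l) <-> exists T, In (StrongQ a B T) l.
Proof.
elim: l => [|[|b C T] l IH] /=; first by split=> // -[].
  rewrite IH; split=> -[T in_l]; exists T; by [right | case: in_l].
rewrite IH; split=> [[[-> ->] | [T' in_l]] | [T' [[<- <- _] | in_l]]].
- by exists T; left.
- by exists T'; right.
- by left.
by right; exists T'.
Qed.

(** Turns weak regularity, stated by indices, into the form used for discharging: a repeated head
    name would occur at index 0 and at a successor. *)
Lemma uniq_pmap_strong (l : seq (qinference L)) :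
    (forall i j a B C T T', nth WeakQ l i = StrongQ a B T ->
      nth WeakQ l j = StrongQ a C T' -> i = j) ->
  uniq (map fst (pmap strong l)).
Proof.
elim: l => //= q l IH inj_l.
have {}IH: uniq (map fst (pmap strong l)).
  by apply: IH => i j a B C T T' Ei Ej; case: (inj_l i.+1 j.+1 _ _ _ _ _ Ei Ej).
case: q inj_l => //= a B T inj_l; rewrite IH andbT.
apply/negP=> /In_mem/In_map[[b C] /In_pmap_strong[T' in_l] /= def_b].
have [j _ Ej] := In_nth WeakQ in_l; rewrite def_b in Ej.
by have := inj_l 0 j.+1 a B C T T' erefl Ej.
Qed.

End LKRules.

Theorem corollary2p9 (L : signature) (S : sequent L) :
  LKplus_derivable S -> LK_derivable S.
Proof.
case: S => G D [d LKd].
(* Suitability is assumed only for indices in range, but beyond it [qinf] is [WeakQ]. *)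
have suit i a B T : qinf d i = StrongQ a B T -> suitable d i.
  move=> def_q; apply: LKd; rewrite ltnNge; apply/negP=> le_i.
  by move: def_q; rewrite /qinf nth_default.
have strongP a B : In (a, B) (pmap (@strong L) (qinferences d)) ->
    exists i T, qinf d i = StrongQ a B T.
  case/In_pmap_strong=> T in_d.
  by have [i _ def_q] := In_nth WeakQ in_d; exists i, T.
apply: (@LK_discharge_all L (pmap (@strong L) (qinferences d))).
- apply: uniq_pmap_strong => i j a B C T T' Ei Ej.
  have := suit _ _ _ _ Ei; rewrite /suitable [qinf d i]Ei => -[_ _ regular].
  by case: (eqVneq j i) => // /eqP/regular/(_ Ej).
- have sub_side a b : side (pmap (@strong L) (qinferences d)) a b ->
      side_variable d a b.
    by case=> B /strongP[i [T def_q]] occ_b; exists i, B, T.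
  apply: (acyclic_sub sub_side) => x cycle_x.
  (* Acyclicity is available only through the suitability of some strong inference; a cycle supplies
     one. *)
  have [a [b [i [B [T [def_q _]]]]]]: exists a b, side_variable d a b.
    by elim: cycle_x => // a b; exists a, b.
  by have := suit _ _ _ _ def_q; rewrite /suitable def_q => -[_ /(_ x)].
- move=> a /In_mem/In_map[[b B] /strongP[i [T def_q]] /= <-].
  by have := suit _ _ _ _ def_q; rewrite /suitable def_q => -[].
apply: (LK_henkin (d := d)) => a B T in_d; apply/In_map.
by exists (a, B) => //; apply/In_pmap_strong; exists T.
Qed.
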